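(* Let $d\in\mathbb N$, $\mathcal P_0\subseteq\mathcal P(\mathbb R^d)$, and let $\{\mathbb P^\zeta\}_{\zeta\in\mathcal P_0}$ and $\{\mathbb Q^\zeta\}_{\zeta\in\mathcal P_0}$ be (time-homogeneous) nonlinear Markov processes such that $$\mathbb P^\zeta\circ(\pi_s,\pi_t)^{-1}=\mathbb Q^\zeta\circ(\pi_s,\pi_t)^{-1}\qquad\text{for all }\zeta\in\mathcal P_0,\ 0\le s\le t.$$ Then $\mathbb P^\zeta=\mathbb Q^\zeta$ for all $\zeta\in\mathcal P_0$.
   Context: $\mathbb R_+=[0,\infty)$. $\mathcal P(T)$ is the set of Borel probability measures on a topological space $T$; $\mathcal P:=\mathcal P(\mathbb R^d)$. $\mathcal C:=C(\mathbb R_+;\mathbb R^d)$ carries the topology of locally uniform convergence and its Borel $\sigma$-algebra; $\pi_t(w)=w(t)$ and $\mathcal F_t=\sigma(\pi_s:0\le s\le t)$. A (time-homogeneous) nonlinear Markov process with initial class $\mathcal P_0\subseteq\mathcal P$ is a family $\{P^\zeta\}_{\zeta\in\mathcal P_0}\subset\mathcal P(\mathcal C)$ such that, with $\mu^\zeta_t:=P^\zeta\circ\pi_t^{-1}$: (i) $\mu_0^\zeta=\zeta$ for all $\zeta\in\mathcal P_0$; (ii) $\mu^\zeta_t\in\mathcal P_0$ for all $t>0$, $\zeta\in\mathcal P_0$; (iii) for all $s,t\ge 0$, $\zeta\in\mathcal P_0$, $A\in\mathcal B(\mathbb R^d)$, $$P^\zeta(\pi_{t+s}\in A\mid\mathcal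 F_s)(\cdot)=P^{\mu^\zeta_s,\pi_s(\cdot)}(\pi_t\in A)\quad P^\zeta\text{-a.s.},$$ where for $\eta\in\mathcal P_0$, $\{P^{\eta,y}\}_{y\in\mathbb R^d}$ is the ($\eta$-a.e. unique) disintegration of $P^\eta$ with respect to $\pi_0$: $y\mapsto P^{\eta,y}(B)$ is measurable, $P^\eta(B)=\int P^{\eta,y}(B)\,d\eta(y)$ for all $B\in\mathcal B(\mathcal C)$, and $P^{\eta,y}(\pi_0=y)=1$ for $\eta$-a.e. $y$. *)

(* Defs.v *)
From HB Require Import structures.
From mathcomp Require Import all_boot all_order all_algebra.
From mathcomp Require Import all_classical all_reals all_analysis.
From mathcomp Require Import giry.

Set Implicit Arguments.
Unset Strict Implicit.
Unset Printing Implicit Defensive.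

Import Order.TTheory GRing.Theory Num.Theory.
Import numFieldNormedType.Exports.

Local Open Scope classical_set_scope.
Local Open Scope ring_scope.

Notation borel T := (g_sigma_algebraType (@open T)).
Notation Rd R d := (borel 'rV[R]_d).

(* The library gives [set_type A] the subspace topology. *)
Notation time R := (set_type [set t : R | 0 <= t]).

Section time.
Context {R : realType}.
Implicit Types s t : time R.

Definition time0 : time R := SigSub (mem_set (lexx 0 : [set t : R | 0 <= t] 0)).

Lemma time_ge0 t : 0 <= set_val t.
Proof. by have := set_mem (valP t). Qed.

Lemma time_add_subproof s t :
  set_val s + set_val t \in [set t : R | 0 <= t].
Proof. by apply/mem_set/addr_ge0; exact: time_ge0. Qed.

Definition time_add s t : time R := SigSub (time_add_subproof s t).

End time.

Definition path_space (R : realType) (d : nat) : Type :=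
  continuousType (time R) 'rV[R]_d.

Section path_space.
Context {R : realType} {d : nat}.

HB.instance Definition _ := Choice.on (path_space R d).

(* Locally uniform convergence is uniform convergence on compact sets, since
   the half-line is locally compact. *)
HB.instance Definition _ := Topological.copy (path_space R d)
  (initial_topology
    (fun w : path_space R d => (w : {family compact, time R -> 'rV[R]_d}))).

Let path0 : path_space R d :=
  HB.pack_for (continuousType (time R) 'rV[R]_d)
    (fun _ : time R => 0 : 'rV[R]_d)
    (isContinuous.Build _ _ _ (@cst_continuous (time R) 'rV[R]_d 0)).
HB.instance Definition _ := isPointed.Build (path_space R d) path0.

End path_space.

Notation paths R d := (borel (path_space R d)).

Section proj_at.
Context {R : realType} {d : nat}.

Definition proj_at (t : time R) (w : paths R d) : Rd R d :=
  (w : continuousType (time R) 'rV[R]_d) t.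

Lemma proj_at_continuous (t : time R) :
  continuous (proj_at t : path_space R d -> 'rV[R]_d).
Proof.
move=> w; pose emb (v : path_space R d) : {family compact, time R -> 'rV[R]_d} :=
  (v : continuousType (time R) 'rV[R]_d).
have cemb : emb v @[v --> w] --> emb w by exact: (@initial_continuous _ _ emb w).
have FF : Filter (emb v @[v --> w]) by exact: (fmap_filter emb (@nbhs_filter _ w)).
have := (fam_cvgP _ _ FF).1 cemb [set t] (@compact_set1 _ t).
by rewrite (uniform_set1 _ _ FF).
Qed.

Lemma measurable_proj_at (t : time R) :
  measurable_fun [set: paths R d] (proj_at t).
Proof.
refine (@measurability _ _ (paths R d) (Rd R d) setT (proj_at t)
  (@open 'rV[R]_d) erefl _).
move=> _ [U oU <-]; apply: sub_sigma_algebra; rewrite setTI.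
by move/continuousP: (@proj_at_continuous t); apply.
Qed.

HB.instance Definition _ (t : time R) :=
  isMeasurableFun.Build _ _ (paths R d) (Rd R d) (proj_at t)
    (measurable_proj_at t).

Definition proj_at2 (s t : time R) (w : paths R d) : Rd R d * Rd R d :=
  (proj_at s w, proj_at t w).

Lemma measurable_proj_at2 (s t : time R) :
  measurable_fun [set: paths R d] (proj_at2 s t).
Proof.
exact: (measurable_fun_pair (measurable_proj_at s) (measurable_proj_at t)).
Qed.

HB.instance Definition _ (s t : time R) :=
  isMeasurableFun.Build _ _ (paths R d) (Rd R d * Rd R d)%type (proj_at2 s t)
    (measurable_proj_at2 s t).

End proj_at.

Section conditional.
Context {disp : measure_display} {T : measurableType disp} {R : realType}.
Variable P : probability T R.

(* [Y] is a version of the conditional expectation of [X] given [F]. *)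
Definition is_cond_exp (F : set (set T)) (X Y : T -> R) : Prop :=
  [/\ forall B : set R, measurable B -> F (Y @^-1` B),
      P.-integrable [set: T] (EFin \o Y) &
      forall B, F B ->
        (\int[P]_(w in B) (Y w)%:E = \int[P]_(w in B) (X w)%:E)%E].

Definition is_cond_prob (F : set (set T)) (A : set T) (Y : T -> R) : Prop :=
  is_cond_exp F \1_A Y.

End conditional.

Section nonlinear_markov.
Context {R : realType} {d : nat}.
Implicit Types (zeta eta : probability (Rd R d) R).

Definition marginal (P : probability (paths R d) R) (t : time R) :
  probability (Rd R d) R := distribution P (proj_at t).

Definition filtration (s : time R) : set (set (paths R d)) :=
  <<s \bigcup_(r in [set r : time R | set_val r <= set_val s])
        g_sigma_algebra_preimage (proj_at r) >>.

Definition is_disintegration eta (P : probability (paths R d) R)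
    (K : R.-pker (Rd R d) ~> (paths R d)) : Prop :=
  (forall B, measurable B -> P B = (\int[eta]_y K y B)%E) /\
  {ae eta, forall y, K y (proj_at time0 @^-1` [set y]) = 1%E}.

(* A [probability] is a set function that is also defined, with arbitrary
   values, on non-measurable sets. A set of Borel probability measures is
   therefore a predicate invariant under [≡μ] (equality on measurable sets),
   and a family indexed by it must respect [≡μ]. *)
Definition measure_class (P0 : set (probability (Rd R d) R)) : Prop :=
  forall zeta eta, zeta ≡μ eta -> P0 zeta -> P0 eta.

Definition measure_family (P0 : set (probability (Rd R d) R))
    (P : probability (Rd R d) R -> probability (paths R d) R) : Prop :=
  forall zeta eta, P0 zeta -> P0 eta -> zeta ≡μ eta -> P zeta ≡μ P eta.

(* [P] is only constrained on [P0]. The kernels [K eta] are the disintegrations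
   of the [P eta]; they exist and are [eta]-a.e. unique because the path space
   is Polish. *)
Definition nonlinear_markov (P0 : set (probability (Rd R d) R))
    (P : probability (Rd R d) R -> probability (paths R d) R) : Prop :=
  [/\ measure_family P0 P,
      forall zeta, P0 zeta -> marginal (P zeta) time0 ≡μ zeta,
      forall zeta (t : time R), P0 zeta -> 0 < set_val t ->
        P0 (marginal (P zeta) t) &
      exists K : probability (Rd R d) R -> R.-pker (Rd R d) ~> (paths R d),
        (forall eta, P0 eta -> is_disintegration eta (P eta) (K eta)) /\
        forall (s t : time R) zeta (A : set (Rd R d)), P0 zeta -> measurable A ->
          exists2 Y : paths R d -> R,
            is_cond_prob (P zeta) (filtration s)
              (proj_at (time_add t s) @^-1` A) Y &
            {ae P zeta, forall w, (Y w)%:E =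
              K (marginal (P zeta) s) (proj_at s w) (proj_at t @^-1` A)}].

End nonlinear_markov.

(* Main.v *)
From HB Require Import structures.
Require Import Defs.
From mathcomp Require Import all_boot all_order all_algebra.
From mathcomp Require Import all_classical all_reals all_analysis.
From mathcomp Require Import giry measurable_realfun lra.
From mathcomp Require finmap.
Import Order.TTheory GRing.Theory Num.Theory.
Import numFieldNormedType.Exports.
Local Open Scope classical_set_scope.
Local Open Scope ring_scope.

(** The nonlinearity is harmless because the initial law is fixed: at a given
    time [s], the transition kernel attached to the marginal at [s] is just some
    function of the position at time [s]. So, for each of the two path laws, the
    conditional probability of being in [B] at time [t + s] given the past up to
    [s] is [k (proj_at s w)] for some [k] ([has_transitions]).

    Integrating [k] over the event that the position at time [s] is in [A] gives
    the probability of being in [A] at time [s] and in [B] at time [t + s], which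
    the two laws share. Hence their transition functions agree almost everywhere
    for the common law of the position at time [s] ([eq_transition_ae]), and
    conditioning on the last but one time shows, by induction on the number of
    times, that the two laws have the same finite-dimensional distributions
    ([eq_cylinder]).

    Finite-dimensional distributions determine a Borel law on the path space: the
    cylinders are stable under intersection, and they generate the Borel sets
    ([borel_sub_cylinders]). For the latter, by compactness and continuity, an
    open set of paths is the union of those finite intersections of sets of the
    form (paths that map a rational time window into a closed ball with rational
    centre and radius) which it contains. There are countably many of these, and
    each is a countable intersection of conditions at rational times. *)

(** * Integrals over an event *)

Section integrals.
Local Open Scope ereal_scope.

Lemma ge0_integral_mrestr {d} {T : measurableType d} {R : realType}
    (mu : {measure set T -> \bar R}) (C : set T) (mC : measurable C)
    (f : T -> \bar R) :
  measurable_fun setT f -> (forall x, 0 <= f x) ->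
  \int[mrestr mu mC]_x f x = \int[mu]_(x in C) f x.
Proof.
move=> mf f0.
have mf' D : measurable_fun D f by exact: measurable_funS mf.
(* The restricted measure vanishes off [C] and equals [mu] on [C]. *)
rewrite -(setUv C) ge0_integral_setU //; last 2 first.
- exact: measurableC.
- exact/disj_setPCl.
rewrite (_ : \int[_]_(x in ~` C) f x = 0) ?adde0; last first.
  apply: null_set_integral => //=; first exact: measurableC.
  by rewrite /mrestr setICl measure0.
apply: eq_measure_integral => A mA AC.
by rewrite /= /mrestr (setIidl AC).
Qed.

(** Both sides are integrals of [f] against the image by [phi] of the measure
    restricted to [C], and the hypothesis says that these images coincide. *)
Lemma eq_integral_law {d d'} {T : measurableType d} {T' : measurableType d'}
    {R : realType} (mu nu : {measure set T -> \bar R}) (phi : T -> T')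
    (C : set T) (f : T' -> \bar R) :
  measurable_fun setT phi -> measurable C ->
  (forall A, measurable A ->
     mu (C `&` phi @^-1` A) = nu (C `&` phi @^-1` A)) ->
  measurable_fun setT f -> (forall y, 0 <= f y) ->
  \int[mu]_(x in C) f (phi x) = \int[nu]_(x in C) f (phi x).
Proof.
move=> mphi mC munu mf f0.
have pushE (m : {measure set T -> \bar R}) :
    \int[m]_(x in C) f (phi x) = \int[pushforward (mrestr m mC) phi]_y f y.
  rewrite [RHS]ge0_integral_pushforward// preimage_setT ge0_integral_mrestr//.
    exact: measurableT_comp.
  by move=> x; exact: f0.
rewrite !pushE; apply: eq_measure_integral => A mA _.
by rewrite /= /pushforward /= /mrestr !(setIC _ C) munu.
Qed.

End integrals.

(** * Cylinders and the Borel sets of the path space *)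

Section borel_paths.
Context {R : realType} {d : nat}.

Lemma measurable_preimage_proj_at {t : time R} {B : set (Rd R d)} :
  measurable B -> measurable (proj_at t @^-1` B).
Proof.
by move=> mB; rewrite -[X in measurable X]setTI; exact: measurable_proj_at.
Qed.

Definition cylinder (l : seq (time R * set (Rd R d))) : set (paths R d) :=
  \big[setI/setT]_(p <- l) (proj_at p.1 @^-1` p.2).

Lemma cylinder_measurable l :
  (forall p, p \in l -> measurable p.2) -> measurable (cylinder l).
Proof.
move=> ml; rewrite /cylinder big_seq.
apply: big_ind => [|A B mA mB|p /ml mp]; first exact: measurableT.
- exact: measurableI.
- exact: measurable_preimage_proj_at.
Qed.

(** The times in [l] may repeat and come in any order: this makes the family
    stable under intersection by concatenation of the lists. *)
Definition cylinders : set (set (paths R d)) :=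
  [set C | exists2 l, (forall p, p \in l -> measurable p.2) & C = cylinder l].

Lemma cylinders_proj_at t (A : set (Rd R d)) :
  measurable A -> cylinders (proj_at t @^-1` A).
Proof.
move=> mA; exists [:: (t, A)]; last by rewrite /cylinder big_seq1.
by move=> p; rewrite inE => /eqP ->.
Qed.

Lemma rat_time_subproof (q : rat) : `|ratr q : R| \in [set t : R | 0 <= t].
Proof. exact/mem_set/normr_ge0. Qed.

(** The absolute value makes every rational an index, so that no proof of
    nonnegativity has to be carried. *)
Definition rat_time (q : rat) : time R := SigSub (rat_time_subproof q).

Definition window (a e : rat) : set (time R) :=
  [set s | `|ratr a - set_val s| < ratr e].

Lemma window_open a e : open (window a e).
Proof.
exists (ball (ratr a : R) (ratr e)); first exact: ball_open.
by rewrite -ball_normE.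
Qed.

(** The radius [q] is less than half the radius [e] of a ball about [s] inside
    [U], and the centre is within [q] of [s]. *)
Lemma window_basis (U : set (time R)) s :
  open U -> U s -> exists a e, window a e s /\ window a e `<=` U.
Proof.
move=> [V oV <-] /= Vs.
have /nbhs_ballP[e /= e0 eV] : nbhs (set_val s) V by exact: open_nbhs_nbhs.
have [q] : exists q, ratr q \in `]0, e / 2[.
  by apply: rat_in_itvoo; rewrite divr_gt0.
rewrite in_itv/= => /andP[q0 qe].
have [a] : exists a, ratr a \in `](set_val s - ratr q), (set_val s)[.
  by apply: rat_in_itvoo; rewrite ltrBlDr ltrDl.
rewrite in_itv/= => /andP[sqa as_].
exists a, q; split.
  by rewrite /window /= ltr_norml; apply/andP; split; lra.
move=> t /=; rewrite /window /= ltr_norml => /andP[t1 t2].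
by apply: eV; rewrite -ball_normE /= ltr_norml; apply/andP; split; lra.
Qed.

Lemma rat_time_dense (U : set (time R)) :
  open U -> U !=set0 -> exists q, U (rat_time q).
Proof.
move=> oU [s Us]; have [a [e [sw wU]]] := window_basis _ _ oU Us.
move: sw; rewrite /window /= ltr_norml => /andP[s1 s2].
have [q] : exists q, ratr q \in `](set_val s), (ratr a + ratr e)[.
  by apply: rat_in_itvoo; lra.
rewrite in_itv/= => /andP[sq qae]; exists q; apply: wU.
have s0 := time_ge0 s.
have qE : set_val (rat_time q) = ratr q :> R by apply: ger0_norm; lra.
by rewrite /window /= qE ltr_norml; apply/andP; split; lra.
Qed.

(** [compact_cover] is stated for pointed spaces; [time0] makes the half-line
    one. *)
Lemma compact_time_cover (A : set (time R)) : compact A -> cover_compact A.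
Proof.
pose T : ptopologicalType := HB.pack_for ptopologicalType (time R)
  (isPointed.Build (time R) time0).
by move=> cA; have : @cover_compact T A by rewrite -(@compact_cover T).
Qed.

Definition tube (U : set (time R)) (B : set 'rV[R]_d) : set (paths R d) :=
  [set w | forall s, U s -> B (proj_at s w)].

(** Paths are continuous, so the constraint at all times of the open set [U]
    follows from the constraint at the rational ones: a time where it fails has a
    whole neighbourhood in [U] where it fails, because [B] is closed. *)
Lemma tube_g_sigma U B :
  open U -> closed B -> <<s cylinders >> (tube U B).
Proof.
move=> oU cB.
rewrite (_ : tube U B = ~` \bigcup_(q : rat)
    (if `[< U (rat_time q) >]
     then proj_at (rat_time q) @^-1` (~` B) else set0)).
  apply: (@measurableC _ (g_sigma_algebraType cylinders)).
  apply: (@bigcupT_measurable_rat _ (g_sigma_algebraType cylinders)) => q.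
  case: asboolP => [Uq|_]; last exact: measurable0.
  apply: sub_sigma_algebra; apply: cylinders_proj_at.
  by apply: sub_sigma_algebra; exact: closed_openC.
apply/seteqP; split => w.
  move=> wUB [q _]; case: asboolP => // Uq /=; apply; exact: wUB.
move=> wq s Us; apply: contrapT => nB; apply: wq.
have [q [Uq nBq]] : exists q, (U `&` proj_at^~ w @^-1` (~` B)) (rat_time q).
  apply: rat_time_dense; last by exists s.
  apply: openI => //; apply: open_comp; last exact: closed_openC.
  by move=> t _; exact: (@cts_fun _ _ w).
by exists q => //; case: asboolP.
Qed.

Lemma rat_vec_dense (x : 'rV[R]_d) (e : R) : 0 < e ->
  exists c : 'rV[rat]_d, `|map_mx ratr c - x| < e.
Proof.
move=> e0.
have /choice[c cP] : forall j, exists q : rat, `|ratr q - x 0 j| < e.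
  move=> j; have [q] : exists q, ratr q \in `](x 0 j - e), (x 0 j + e)[.
    by apply: rat_in_itvoo; lra.
  rewrite in_itv/= => /andP[? ?]; exists q.
  by rewrite ltr_norml; apply/andP; split; lra.
exists (\row_j c j).
suff : ball (map_mx ratr (\row_j c j) : 'rV[R]_d) e x by rewrite -ball_normE.
by split => // i j; rewrite !mxE ord1 -ball_normE /= cP.
Qed.

Definition tube_index : Type := (rat * rat * 'rV[rat]_d * rat)%type.

Definition rat_tube (i : tube_index) : set (paths R d) :=
  tube (window i.1.1.1 i.1.1.2)
    (closed_ball_ (fun x => `|x|) (map_mx ratr i.1.2) (ratr i.2)).

Definition rat_tubes (l : seq tube_index) : set (paths R d) :=
  \bigcap_(i in [set` l]) rat_tube i.

(** The finite intersections of rational tubes are a countable network of the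
    path space: a compact set of times is covered by finitely many windows on
    which [w] stays in a small ball, and a path that stays in the same balls is
    uniformly close to [w] there. *)
Lemma rat_tube_basis (O : set (path_space R d)) (w : path_space R d) :
  open O -> O w -> exists l : seq tube_index,
    rat_tubes l w /\ rat_tubes l `<=` O.
Proof.
move=> [V oV OE] Ow.
pose emb (v : path_space R d) : {family compact, time R -> 'rV[R]_d} :=
  (v : continuousType (time R) 'rV[R]_d).
pose F : set_system (path_space R d) :=
  filter_from [set l | rat_tubes l w] rat_tubes.
have FF : Filter F.
  apply: filter_from_filter; first by exists [::] => i.
  move=> l1 l2 l1w l2w; exists (l1 ++ l2).
    by move=> i /=; rewrite mem_cat => /orP[]; [exact: l1w|exact: l2w].
  by move=> v lv; split => i /= il; apply: lv; rewrite /= mem_cat il ?orbT.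
(* It suffices that [w] is the limit of its tube neighbourhoods, and uniform
   convergence on each compact set [A] is enough for that. *)
suff /(_ V) : emb @ F --> emb w.
  case; first by apply: open_nbhs_nbhs; split => //; rewrite -OE in Ow.
  by move=> l lw lO; exists l; split => //; rewrite -OE.
apply/fam_cvgP => A cA P /uniform_nbhs[E [entE EP]].
have [e e0 eE] : exists2 e : R, 0 < e & [set xy | ball xy.1 e xy.2] `<=` E.
  by move: entE; rewrite -entourage_ballE.
(* A centre within [r] of both paths leaves them [2 * r < e] apart. *)
have [r] : exists q, ratr q \in `]0, e / 2[.
  by apply: rat_in_itvoo; rewrite divr_gt0.
rewrite in_itv/= => /andP[r0 re].
pose D : set tube_index := [set i | i.2 = r /\ rat_tube i w].
case: (compact_time_cover _ cA tube_index D (fun i => window i.1.1.1 i.1.1.2)).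
- by move=> i _; exact: window_open.
- move=> s As.
  have [c cs] := rat_vec_dense (emb w s) (ratr r) r0.
  pose W := emb w @^-1` ball (map_mx ratr c : 'rV[R]_d) (ratr r).
  have oW : open W.
    by apply: open_comp; [move=> t _; exact: (@cts_fun _ _ w)|exact: ball_open].
  have Ws : W s by rewrite /W /= -ball_normE.
  have [a [q [sw wW]]] := window_basis _ _ oW Ws.
  exists (a, q, c, r) => //; split => // t /wW.
  by rewrite /W /= -ball_normE /= => /ltW.
- move=> D' D'D AD'; exists (finmap.enum_fset D').
    by move=> i /= /D'D/set_mem[].
  move=> v vD'; apply: EP => s /AD'[i iD' si]; apply: eE => /=.
  have [ir iw] := set_mem (D'D _ iD').
  have := vD' i iD' s si; have := iw s si.
  rewrite ir /closed_ball_ -ball_normE /= => h1 h2.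
  rewrite /emb.
  rewrite (le_lt_trans (ler_distD (map_mx ratr i.1.2) _ _))//.
  rewrite (@distrC _ _ (w s)).
  by apply: le_lt_trans (lerD h1 h2) _; lra.
Qed.

(** An open set is the union of the finite intersections of rational tubes
    inside it, and there are countably many of those. *)
Lemma borel_sub_cylinders : @measurable _ (paths R d) `<=` <<s cylinders >>.
Proof.
apply: smallest_sub; first exact: smallest_sigma_algebra.
move=> O oO.
rewrite (_ : O = \bigcup_(l : seq tube_index)
    (if `[< rat_tubes l `<=` O >] then rat_tubes l else set0)).
  apply: (@countable_bigcupT_measurable _ (g_sigma_algebraType cylinders)) => [|l].
    exact: (@countableP (seq (rat * rat * 'rV[rat]_d * rat)%type)).
  case: asboolP => [_|_]; last exact: measurable0.
  rewrite /rat_tubes classical_sets.bigcap_seq; apply: big_ind => [|A B mA mB|i _].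
  - exact: (@measurableT _ (g_sigma_algebraType cylinders)).
  - exact: (@measurableI _ (g_sigma_algebraType cylinders)).
  - by apply: tube_g_sigma; [exact: window_open|exact: closed_closed_ball_].
apply/seteqP; split => w.
  by move=> /(rat_tube_basis _ _ oO)[l [lw lO]]; exists l => //; case: asboolP.
by move=> [l _]; case: asboolP => // lO; exact: lO.
Qed.

Lemma cylinder_measure_unique (mu nu : probability (paths R d) R) :
  (forall l, (forall p, p \in l -> measurable p.2) ->
    mu (cylinder l) = nu (cylinder l)) ->
  mu ≡μ nu.
Proof.
move=> munu A mA.
apply: (@g_sigma_algebra_measure_unique _ _ _ cylinders _ (fun=> setT)).
- by move=> _ [l ml ->]; exact: cylinder_measurable.
- by move=> _; exists [::] => //; rewrite /cylinder big_nil.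
- by rewrite bigcup_const.
- move=> _ _ [l ml ->] [l' ml' ->]; exists (l ++ l').
    by move=> p; rewrite mem_cat => /orP[]; [exact: ml|exact: ml'].
  by rewrite /cylinder big_cat.
- by move=> _ [l ml ->]; exact: munu.
- by move=> _; apply: le_lt_trans (probability_le1 _ measurableT) (ltry _).
- exact: borel_sub_cylinders.
Qed.

End borel_paths.

(** * Path laws with the Markov property *)

Section markov.
Context {R : realType} {d : nat}.
Local Open Scope ereal_scope.
Implicit Types (s t : time R) (mu nu : probability (paths R d) R).

Lemma filtration_measurable s : filtration s `<=` @measurable _ (paths R d).
Proof.
apply: smallest_sub; first exact: sigma_algebra_measurable.
by move=> _ [r _ [A mA <-]]; apply: measurable_proj_at.
Qed.

Lemma filtration_proj_at {s t} {A : set (Rd R d)} :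
  (set_val s <= set_val t)%R -> measurable A -> filtration t (proj_at s @^-1` A).
Proof.
move=> st mA; apply: sub_sigma_algebra; exists s => //.
by exists A => //; rewrite setTI.
Qed.

Lemma filtrationS {s t} :
  (set_val s <= set_val t)%R -> filtration s `<=` @filtration R d t.
Proof.
move=> st; apply: sub_sigma_algebra2 => A [r rs Ar]; exists r => //.
exact: le_trans st.
Qed.

Lemma filtrationT s : filtration s [set: paths R d].
Proof. by rewrite -(preimage_setT (proj_at s)); exact: filtration_proj_at. Qed.

Lemma filtrationI {s} {A B : set (paths R d)} :
  filtration s A -> filtration s B -> filtration s (A `&` B).
Proof.
by move=> FA FB; apply: (@measurableI _ (g_sigma_algebraType
  (\bigcup_(r in [set r : time R | (set_val r <= set_val s)%R])
     g_sigma_algebra_preimage (@proj_at R d r)))).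
Qed.

(** The part of the Markov property that determines a path law from its two-time
    marginals: the conditional probabilities given the past are functions of the
    present. The function [k] may depend on [s] and on [mu] in any way, as it does
    for a nonlinear Markov process. *)
Definition has_transitions mu : Prop :=
  forall s t (B : set (Rd R d)), measurable B ->
  exists k : Rd R d -> \bar R,
    [/\ measurable_fun setT k, forall y, 0 <= k y &
      forall C, filtration s C ->
        mu (C `&` proj_at (time_add t s) @^-1` B) =
        \int[mu]_(w in C) k (proj_at s w)].

(** The transition function is the kernel of the marginal of [P zeta] at [s],
    evaluated on the event that the position at time [t] is in [B]. *)
Lemma nonlinear_markov_has_transitions
    (P0 : set (probability (Rd R d) R))
    (P : probability (Rd R d) R -> probability (paths R d) R)
    (zeta : probability (Rd R d) R) :
  nonlinear_markov P0 P -> P0 zeta -> has_transitions (P zeta).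
Proof.
move=> [_ _ _ [K [_ PK]]] P0z s t B mB.
have [Y [_ iY condY] YK] := PK s t zeta B P0z mB.
have mtB : measurable (@proj_at R d t @^-1` B).
  exact: measurable_preimage_proj_at.
have mK : measurable_fun setT
    (fun y => K (marginal (P zeta) s) y (proj_at t @^-1` B)).
  exact: measurable_kernel.
exists (fun y => K (marginal (P zeta) s) y (proj_at t @^-1` B)).
split => // C FC.
have mC := filtration_measurable _ _ FC.
have mtsB : measurable (@proj_at R d (time_add t s) @^-1` B).
  exact: measurable_preimage_proj_at.
rewrite setIC -(integral_indic (P zeta) mC mtsB) -condY//.
apply: ae_eq_integral => //.
- exact: measurable_funS (measurable_int _ iY).
- by apply: measurable_funS (measurableT_comp mK (measurable_proj_at s)).
- by apply: filterS YK => w /= ->.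
Qed.

(** Taking for [C] the event that the position at time [s] is in [A] shows that
    [k] and [l] have the same integral over every [A] for the common law of the
    position at time [s]. *)
Lemma eq_transition_ae mu nu s t (B : set (Rd R d)) (k l : Rd R d -> \bar R) :
  measurable B ->
  measurable_fun setT k -> measurable_fun setT l ->
  (forall y, 0 <= k y) -> (forall y, 0 <= l y) ->
  (forall C, filtration s C ->
    mu (C `&` proj_at (time_add t s) @^-1` B) =
    \int[mu]_(w in C) k (proj_at s w)) ->
  (forall C, filtration s C ->
    nu (C `&` proj_at (time_add t s) @^-1` B) =
    \int[nu]_(w in C) l (proj_at s w)) ->
  distribution mu (proj_at2 s (time_add t s)) ≡μ
    distribution nu (proj_at2 s (time_add t s)) ->
  ae_eq mu setT (k \o proj_at s) (l \o proj_at s).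
Proof.
move=> mB mk ml k0 l0 muk nul mn.
have mn2 A : measurable A ->
    mu (proj_at s @^-1` A `&` proj_at (time_add t s) @^-1` B) =
    nu (proj_at s @^-1` A `&` proj_at (time_add t s) @^-1` B).
  by move=> mA; exact: (mn _ (measurableX mA mB)).
have mn1 A : measurable A -> mu (proj_at s @^-1` A) = nu (proj_at s @^-1` A).
  move=> mA; have := mn _ (measurableX mA measurableT).
  rewrite /= /distribution /= /pushforward.
  rewrite (_ : _ @^-1` (A `*` setT) = proj_at s @^-1` A)//.
  by apply/seteqP; split => w //= [].
have pushE f A :
    measurable_fun setT f -> (forall y, 0 <= f y) -> measurable A ->
    \int[distribution mu (proj_at s)]_(y in A) f y =
    \int[mu]_(w in proj_at s @^-1` A) f (proj_at s w).
  move=> mf f0 mA; rewrite ge0_integral_pushforward//.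
  exact: measurable_funS mf.
have eqkl A : measurable A ->
    \int[distribution mu (proj_at s)]_(y in A) k y =
    \int[distribution mu (proj_at s)]_(y in A) l y.
  move=> mA; rewrite !pushE//.
  have FA := filtration_proj_at (lexx (set_val s)) mA.
  rewrite -muk// mn2// nul//; apply: (eq_integral_law _ _ (proj_at s)) => //.
    exact: measurable_preimage_proj_at.
  by move=> A' mA'; apply/esym; exact: (mn1 _ (measurableI _ _ mA mA')).
have ik : (distribution mu (proj_at s)).-integrable setT k.
  apply/integrableP; split => //.
  under eq_integral do rewrite gee0_abs//.
  rewrite pushE// preimage_setT -muk ?setTI; last exact: filtrationT.
  apply: le_lt_trans (probability_le1 _ _) (ltry _).
  exact: measurable_preimage_proj_at.
have [|N [mN N0 kl]] := integral_ae_eq measurableT ik ml.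
  by move=> A _; exact: eqkl.
exists (proj_at s @^-1` N); split => //.
  exact: measurable_preimage_proj_at.
by move=> w klw; exact: kl.
Qed.

(** Since [k] and [l] agree almost everywhere, both probabilities are integrals
    of [l] against the law of the position at time [s] on the event [C], which is
    the same for [mu] and [nu]. *)
Lemma eq_cylinder_step {mu nu s t C} :
  has_transitions mu -> has_transitions nu ->
  distribution mu (proj_at2 s (time_add t s)) ≡μ
    distribution nu (proj_at2 s (time_add t s)) ->
  filtration s C ->
  (forall A, measurable A ->
    mu (C `&` proj_at s @^-1` A) = nu (C `&` proj_at s @^-1` A)) ->
  forall B, measurable B ->
    mu (C `&` proj_at (time_add t s) @^-1` B) =
    nu (C `&` proj_at (time_add t s) @^-1` B).
Proof.
move=> Tmu Tnu mn FC munuC B mB.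
have [k [mk k0 muk]] := Tmu s t B mB; have [l [ml l0 nul]] := Tnu s t B mB.
have kl := eq_transition_ae _ _ _ _ _ _ _ mB mk ml k0 l0 muk nul mn.
have mC := filtration_measurable _ _ FC.
have mcomp f : measurable_fun setT f ->
    measurable_fun C (f \o @proj_at R d s : _ -> \bar R).
  move=> mf.
  by apply: measurable_funS (measurableT_comp mf (measurable_proj_at s)).
rewrite muk// nul//.
rewrite -(eq_integral_law mu nu _ _ _ (measurable_proj_at s) mC munuC ml l0).
apply: ae_eq_integral => //; [exact: mcomp|exact: mcomp|].
by apply: filterS kl => w /= + _; exact.
Qed.

Definition time_le : rel (time R) := fun s t => (set_val s <= set_val t)%R.

Lemma time_add_surj {s t} : (set_val s <= set_val t)%R ->
  exists u : time R, t = time_add u s.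
Proof.
move=> st.
have ut : (set_val t - set_val s \in [set t : R | (0 <= t)%R])%R.
  by apply/mem_set; rewrite /= subr_ge0.
by exists (SigSub ut); apply: val_inj => /=; rewrite subrK.
Qed.

(** The induction carries the past event [C] and the law on [C] of the position
    at the latest time [s]: this is what a step from [s] to the next time of [l]
    consumes and reproduces. *)
Lemma eq_sorted_cylinder mu nu s C l :
  has_transitions mu -> has_transitions nu ->
  (forall s t, (set_val s <= set_val t)%R ->
     distribution mu (proj_at2 s t) ≡μ distribution nu (proj_at2 s t)) ->
  (forall p, p \in l -> measurable p.2) ->
  filtration s C ->
  (forall A, measurable A ->
    mu (C `&` proj_at s @^-1` A) = nu (C `&` proj_at s @^-1` A)) ->
  path time_le s [seq p.1 | p <- l] ->
  mu (C `&` cylinder l) = nu (C `&` cylinder l).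
Proof.
move=> Tmu Tnu mn; elim: l s C => [|[t B] l IH] s C ml FC munuC.
  move=> _; rewrite /cylinder big_nil -(preimage_setT (proj_at s)).
  exact: munuC.
rewrite /= => /andP[st lt].
have mB : measurable B by apply: (ml (t, B)); rewrite inE eqxx.
rewrite /cylinder big_cons /= setIA; apply: (IH t) => //.
- by move=> p pl; apply: ml; rewrite inE pl orbT.
- apply: filtrationI (filtrationS st _ FC) _.
  exact: filtration_proj_at.
- move=> A' mA'; rewrite -setIA -preimage_setI.
  have [u tE] := time_add_surj st; subst t.
  apply: (eq_cylinder_step Tmu Tnu (mn _ _ st) FC munuC).
  exact: measurableI.
Qed.

Lemma eq_cylinder mu nu l :
  has_transitions mu -> has_transitions nu ->
  (forall s t, (set_val s <= set_val t)%R ->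
     distribution mu (proj_at2 s t) ≡μ distribution nu (proj_at2 s t)) ->
  (forall p, p \in l -> measurable p.2) -> mu (cylinder l) = nu (cylinder l).
Proof.
move=> Tmu Tnu mn ml.
have lE : cylinder l = cylinder (sort (relpre fst time_le) l).
  by apply: perm_big; rewrite perm_sym; exact/permEl/perm_sort.
(* The two-time law at the pair (0, 0) contains the initial law. *)
have mn0 : distribution mu (proj_at2 time0 time0) ≡μ
    distribution nu (proj_at2 time0 time0) by exact: mn.
rewrite lE -(setTI (cylinder _)); apply: (eq_sorted_cylinder _ _ time0) => //.
- by move=> p; rewrite mem_sort; exact: ml.
- exact: filtrationT.
- move=> A mA; have := mn0 _ (measurableX mA mA).
  rewrite /= /distribution /= /pushforward.
  rewrite (_ : _ @^-1` _ = setT `&` proj_at time0 @^-1` A)//.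
  by apply/seteqP; split => w //= [].
- rewrite path_min_sorted; last by apply/allP => t _; exact: time_ge0.
  by rewrite sorted_map; apply: sort_sorted => p q; exact: le_total.
Qed.

End markov.

Theorem theorem1p2 (R : realType) (d : nat)
  (P0 : set (probability (Rd R d) R))
  (P Q : probability (Rd R d) R -> probability (paths R d) R)
  (hP0 : measure_class P0)
  (hP : nonlinear_markov P0 P) (hQ : nonlinear_markov P0 Q)
  (hPQ : forall (zeta : probability (Rd R d) R) (s t : time R),
    P0 zeta -> set_val s <= set_val t ->
    distribution (P zeta) (proj_at2 s t) ≡μ distribution (Q zeta) (proj_at2 s t)) :
  forall zeta : probability (Rd R d) R, P0 zeta -> P zeta ≡μ Q zeta.
Proof.
move=> zeta P0z; apply: cylinder_measure_unique => l ml.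
apply: eq_cylinder => //.
- exact: nonlinear_markov_has_transitions hP P0z.
- exact: nonlinear_markov_has_transitions hQ P0z.
- by move=> s t; exact: hPQ.
Qed.
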